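(* $4$-webs whose basic invariant is constant on the leaves of one of the web foliations exist, and (for each choice of the foliation $X_1$, $X_2$, $X_3$ or $X_4$) the general solution of the system of equations defining such webs depends on one arbitrary function of two variables.
   Context: Let $M^2$ be a two-dimensional analytic manifold. A $4$-web is given in an open domain $D\subset M^2$ by four foliations $X_1,X_2,X_3,X_4$ of curves such that the tangents to the curves of different foliations through any point of $D$ are distinct, and two curves of different foliations have at most one common point in $D$. All functions and forms are real of class $C^\infty$ (or holomorphic in the complex case). The foliation $X_\alpha$, $\alpha=1,2,3$, is defined by $\omega_\alpha=0$, where the $1$-forms are normalized so that $\omega_1+\omega_2+\omega_3=0$. There is a unique $1$-form $\theta$ with $d\omega_\alpha=\omega_\alpha\wedge\theta$, and the curvature $K$ of the $3$-subweb $[1,2,3]$ is defined by $d\theta=K\,\omega_1\wedge\omega_2$; one has $dK-2K\theta=K_1\omega_1+K_2\omega_2$. The foliation $X_4$ is defined by $\omega_4=0$, where $-\omega_4=a\omega_1+\omega_2$; the function $a\neq0,1$ is the basic invariant, and $da=a_1\omega_1+a_2\omega_2$. The system of equations defining $4$-webs whose basic invariant is constant on the leaves of $X_c$ consists of the structure equations $d\omega_\alpha=\omega_\alpha\wedge\theta$, $d\theta=K\omega_1\wedge\omega_2$, the Pfaffian equation $dK-2K\theta=K_1\omega_1+K_2\omega_2$, and the Pfaffian equation $da=a_1\omega_1$ for $c=1$; $da=a_2\omega_2$ for $c=2$; $da=a_1(\omega_1+\omega_2)$ for $c=3$; $da=a_2(a\omega_1+\omega_2)$ for $c=4$. ''Depends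 on $k$ functions of $m$ variables'' is meant in the sense of Cartan's theory of exterior differential systems in involution (the last nonzero Cartan character is $s_m=k$). *)

(* Defs.v *)
From HB Require Import structures.
From mathcomp Require Import all_boot all_order all_algebra.
From mathcomp Require Import all_classical all_reals all_analysis.
From mathcomp Require Export complex.

Set Implicit Arguments.
Unset Strict Implicit.
Unset Printing Implicit Defensive.

Import Order.TTheory GRing.Theory Num.Theory.
Import numFieldNormedType.Exports.

Local Open Scope classical_set_scope.
Local Open Scope ring_scope.

(* Everything is parametrized by a scalar field F; the two cases of interest
   are F = R (class C^oo) and F = R[i] (holomorphic), for R : realType. *)

(** * Exterior differential systems given by structure equations *)

(* The unknowns are an n-coframe w^1, ..., w^n and N functions z^1, ..., z^N.
   A system consists of structure equations dw^i = Omega^i(z), with Omega^i a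
   2-form, and of Pfaffian equations phi(z) = 0 in w^1, ..., w^n, dz^1, ..., dz^N.
   A tangent vector is a row v : 'rV_(n + N); lsubmx v lists the values
   w^i(v) and rsubmx v the values dz^j(v). The coframe is not expressed in
   coordinates, so that solutions are counted up to diffeomorphism. *)

Record cartan_system (F : numFieldType) (n N : nat) := CartanSystem {
  cs_values : set 'rV[F]_N ;
  cs_dcoframe : 'rV[F]_N -> 'I_n -> 'rV[F]_(n + N) -> 'rV[F]_(n + N) -> F ;
  cs_pfaff : seq ('rV[F]_N -> 'rV[F]_(n + N) -> F) }.

Definition wedge (F : numFieldType) (V : Type) (alpha beta : V -> F) : V -> V -> F :=
  fun u v => alpha u * beta v - alpha v * beta u.

Section ExteriorDerivative.
Variables (F : numFieldType) (n N : nat) (S : cartan_system F n N).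
Local Notation V := 'rV[F]_(n + N).

(* The bracket of the vector fields u and v with constant components in the
   frame dual to (w, dz): w^i([u, v]) = - dw^i(u, v) and dz^j([u, v]) = 0. *)
Definition bracket (z : 'rV[F]_N) (u v : V) : V :=
  row_mx (\row_i - cs_dcoframe S z i u v) 0.

(* dphi(u, v) = u(phi(v)) - v(phi(u)) - phi([u, v]); the frame field u acts
   on functions of z as the derivative in the direction rsubmx u. *)
Definition ext_d1 (phi : 'rV[F]_N -> V -> F) (z : 'rV[F]_N) (u v : V) : F :=
  'D_(rsubmx u) (fun y => phi y v : F^o) z
  - 'D_(rsubmx v) (fun y => phi y u : F^o) z
  - phi z (bracket z u v).

Definition ext_d2 (Om : 'rV[F]_N -> V -> V -> F) (z : 'rV[F]_N) (u v w : V) : F :=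
  'D_(rsubmx u) (fun y => Om y v w : F^o) z
  + 'D_(rsubmx v) (fun y => Om y w u : F^o) z
  + 'D_(rsubmx w) (fun y => Om y u v : F^o) z
  - Om z (bracket z u v) w - Om z (bracket z v w) u - Om z (bracket z w u) v.

End ExteriorDerivative.

Section CartanTest.
Variables (F : numFieldType) (n N : nat) (S : cartan_system F n N).
Local Notation V := 'rV[F]_(n + N).

(* The closed system attached to S is generated by the Pfaffian forms phi,
   the exterior quadratic forms dphi and the 3-forms d(dw^i). *)
Definition pfaff1 (phi : 'rV[F]_N -> V -> F) : Prop :=
  exists2 j, (j < size (cs_pfaff S))%N & phi = nth (fun _ _ => 0) (cs_pfaff S) j.

Definition ddcoframe (z : 'rV[F]_N) (i : 'I_n) : V -> V -> V -> F :=
  ext_d2 S (fun y => cs_dcoframe S y i) z.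

Definition integral_element (z : 'rV[F]_N) (E : {vspace V}) : Prop :=
  [/\ forall phi, pfaff1 phi -> {in E, forall v, phi z v = 0},
      forall phi, pfaff1 phi -> {in E &, forall u v, ext_d1 S phi z u v = 0}
    & forall i, {in E & &, forall u v w, ddcoframe z i u v w = 0}].

Definition polar_vector (z : 'rV[F]_N) (E : {vspace V}) (v : V) : Prop :=
  [/\ forall phi, pfaff1 phi -> phi z v = 0,
      forall phi, pfaff1 phi -> {in E, forall u, ext_d1 S phi z v u = 0}
    & forall i, {in E &, forall u w, ddcoframe z i v u w = 0}].

Definition polar_codim (z : 'rV[F]_N) (E : {vspace V}) (c : nat) : Prop :=
  exists2 H : {vspace V},
    (\dim H + c = n + N)%N & forall v, polar_vector z E v <-> v \in H.

(* c is the codimension of the polar space of a generic k-dimensional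
   subspace of E: genericity amounts to maximality of the codimension. *)
Definition generic_polar_codim (z : 'rV[F]_N) (E : {vspace V}) (k c : nat) : Prop :=
  (exists E' : {vspace V}, [/\ (E' <= E)%VS, \dim E' = k & polar_codim z E' c]) /\
  (forall (E' : {vspace V}) c', (E' <= E)%VS -> \dim E' = k ->
     polar_codim z E' c' -> (c' <= c)%N).

(* The n-plane dz = w p, on which w^1, ..., w^n are independent. *)
Definition graph_plane (p : 'M[F]_(n, N)) : {vspace V} :=
  <<[seq row i (row_mx 1%:M p) | i <- enum 'I_n]>>%VS.

(* Cartan's test: over every admissible z, the integral n-elements on which
   the w^i are independent form a non-empty affine space, whose dimension is
   s_1 + 2 s_2 + ... + n s_n. *)
Definition involutive_with_characters (s : nat -> nat) : Prop :=
  forall z, cs_values S z ->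
    (exists (p0 : 'M[F]_(n, N)) (U : {vspace 'M[F]_(n, N)}),
       (forall p, integral_element z (graph_plane p) <-> p - p0 \in U) /\
       \dim U = (\sum_(1 <= k < n.+1) k * s k)%N) /\
    (forall p, integral_element z (graph_plane p) ->
       forall k, (k <= n)%N ->
       generic_polar_codim z (graph_plane p) k (\sum_(0 <= j < k.+1) s j)%N).

Definition general_solution_depends_on (k m : nat) : Prop :=
  exists s : nat -> nat,
    [/\ involutive_with_characters s,
        (0 < k)%N, (0 < m <= n)%N, s m = k
      & forall j, (m < j <= n)%N -> s j = 0%N].

End CartanTest.

(** * 4-webs *)

Inductive foliation := X1 | X2 | X3 | X4.

Section Webs.
Variable F : numFieldType.

(* All iterated directional derivatives exist and are differentiable. *)
Definition smooth_on (V W : normedModType F) (D : set V) (f : V -> W) : Prop :=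
  forall (us : seq V) x, D x ->
    differentiable (foldr (fun u (g : V -> W) => 'D_u g) f us) x.

(* A 1-form on the plane is given by its columns of coefficients, so that
   its value at x on the tangent vector v is v *m w x. *)
Definition integral_curve (D : set 'rV[F]_2) (w : 'rV[F]_2 -> 'cV[F]_2)
    (I : set F^o) (g : F^o -> 'rV[F]_2) : Prop :=
  [/\ open I, connected I, smooth_on I g, g @` I `<=` D
    & forall t, I t -> 'D_1 g t != 0 /\ 'D_1 g t *m w (g t) = 0].

(* The 4-web on D given by the foliations {w X = 0}, with the normalization
   w X1 + w X2 + w X3 = 0 and - w X4 = a w X1 + w X2; a is the basic invariant. *)
Definition is_4web (D : set 'rV[F]_2) (w : foliation -> 'rV[F]_2 -> 'cV[F]_2)
    (a : 'rV[F]_2 -> F^o) : Prop :=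
  [/\ [/\ open D, connected D & D !=set0],
      smooth_on D a /\ (forall X, smooth_on D (w X)),
      forall x, D x -> w X1 x + w X2 x + w X3 x = 0 /\
                       - w X4 x = a x *: w X1 x + w X2 x,
      forall X Y x, X <> Y -> D x -> row_mx (w X x) (w Y x) \in unitmx
    & forall X Y I J g h, X <> Y ->
        integral_curve D (w X) I g -> integral_curve D (w Y) J h ->
        forall x y, (g @` I) x -> (h @` J) x -> (g @` I) y -> (h @` J) y -> x = y].

Definition constant_on_leaves (D : set 'rV[F]_2) (w : 'rV[F]_2 -> 'cV[F]_2)
    (a : 'rV[F]_2 -> F^o) : Prop :=
  forall I g, integral_curve D w I g -> forall s t, I s -> I t -> a (g s) = a (g t).

(** ** The system defining webs with basic invariant constant on leaves *)

(* The coframe is (w1, w2, theta). Here theta is independent of w1 and w2, as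
   it is when the common factor of the normalized forms w1, w2, w3 is kept as
   a group parameter. The functions are z = (K, a, K1, K2, b), where b is the
   coefficient of da: a1 for X1 and X3, a2 for X2 and X4. *)
Local Notation V := 'rV[F]_(3 + 5).

Definition w1 (v : V) : F := lsubmx v 0 0.
Definition w2 (v : V) : F := lsubmx v 0 1.
Definition theta (v : V) : F := lsubmx v 0 2.
Definition dK (v : V) : F := rsubmx v 0 0.
Definition da (v : V) : F := rsubmx v 0 1.

Definition vK (z : 'rV[F]_5) : F := z 0 0.
Definition va (z : 'rV[F]_5) : F := z 0 1.
Definition vK1 (z : 'rV[F]_5) : F := z 0 2.
Definition vK2 (z : 'rV[F]_5) : F := z 0 3.
Definition vb (z : 'rV[F]_5) : F := z 0 4.

Definition leaf_form (c : foliation) (z : 'rV[F]_5) (v : V) : F :=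
  match c with
  | X1 => w1 v
  | X2 => w2 v
  | X3 => w1 v + w2 v
  | X4 => va z * w1 v + w2 v
  end.

Definition web_system (c : foliation) : cartan_system F 3 5 :=
  CartanSystem
    [set z | va z != 0 /\ va z != 1]
    (fun z i => nth (fun _ _ => 0)
       [:: wedge w1 theta;
           wedge w2 theta;
           fun u v => vK z * wedge w1 w2 u v] i)
    [:: fun z v => dK v - 2 * vK z * theta v - (vK1 z * w1 v + vK2 z * w2 v);
        fun z v => da v - vb z * leaf_form c z v].

End Webs.

(* Main.v *)
Require Import Defs.
From HB Require Import structures.
From mathcomp Require Import all_boot all_order all_algebra.
From mathcomp Require Import all_classical all_reals all_analysis.
From mathcomp Require Import complex ring.
Import numFieldNormedType.Exports.
Import Order.TTheory GRing.Theory Num.Theory.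

Set Implicit Arguments.
Unset Strict Implicit.
Unset Printing Implicit Defensive.

Local Open Scope classical_set_scope.
Local Open Scope ring_scope.

(** Existence: the four foliations by the level curves of x, y, x + y^2 and
    x + y, suitably matched with X1, ..., X4, form a web near y = 2 whose basic
    invariant is a function of y alone, and y is a first integral of X_c.

    Involutivity: put pi1 = dK1 - 3 K1 theta, pi2 = dK2 - 3 K2 theta + 2 K^2 w1
    and pi3 = db - b theta (minus b^2 w1 when c is X4), and let lambda be the
    form defining X_c. Modulo the Pfaffian equations the exterior derivatives
    of these equations are - (pi1 /\ w1 + pi2 /\ w2) and - pi3 /\ lambda, while
    all d(dw^i) vanish. By Cartan's lemma an integral element is
    pi1 = h11 w1 + h12 w2, pi2 = h12 w1 + h22 w2, pi3 = h lambda, so there is a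
    4-parameter family of them; a generic flag has polar spaces of codimension
    2, 4, 5, 5, hence s0 = 2, s1 = 2, s2 = 1, s3 = 0, and s1 + 2 s2 + 3 s3 = 4. *)

(** * Directional derivatives of explicit maps *)

(** For [h] nonzero the difference quotient is exactly [l + h *: q], which tends to [l]. All
    coefficients met below are at most quadratic along lines, so this computes their derivatives. *)
Lemma derive_quadratic (F : numFieldType) (V W : normedModType F) (f : V -> W)
    (z d : V) (l q : W) :
  (forall h : F, f (h *: d + z) = f z + h *: l + h ^+ 2 *: q) -> 'D_d f z = l.
Proof.
move=> fE; apply/cvg_lim => //.
have : (fun h : F^o => l + h *: q) @ 0^' --> l + (0 : F) *: q.
  apply: cvgD; first exact: cvg_cst.
  by apply: cvgZr_tmp; apply: cvg_within.
rewrite scale0r addr0; apply: cvg_trans; apply: near_eq_cvg.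
near=> h => /=; rewrite fE -[f z + _ + _]addrA [f z + _]addrC addrK.
rewrite scalerDr !scalerA expr2 mulrA mulVf ?mul1r ?scale1r //.
by near: h; apply: nbhs_dnbhs_neq.
Unshelve. all: by end_near. Qed.

Lemma derive_comp (F : numFieldType) (U V W: normedModType F) (f : V -> W)
    (g : U -> V) (x u : U) :
  differentiable g x -> differentiable f (g x) ->
  'D_u (f \o g) x = 'D_('D_u g x) f (g x).
Proof.
move=> dg df; have dfg := differentiable_comp dg df.
by rewrite !deriveE // diff_comp.
Qed.

(** * Real scalars in the ground field *)

(* A common description of R and R[i], so that segments, connectedness and
   the mean value theorem can be treated uniformly. *)
Record real_scalars (R : realType) (F : numFieldType) := RealScalars {
  of_real : {rmorphism R -> F} ;
  re : F -> R ;
  im : F -> R ;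
  of_real_continuous : continuous (of_real : R -> F^o) ;
  norm_of_real_le1 : forall t : R, 0 <= t <= 1 -> `|of_real t| <= 1 ;
  re_continuous : continuous (re : F^o -> R) ;
  im_continuous : continuous (im : F^o -> R) ;
  re_sub : forall x y, re (x - y) = re x - re y ;
  im_sub : forall x y, im (x - y) = im x - im y ;
  re_scale : forall t x, re (of_real t * x) = t * re x ;
  im_scale : forall t x, im (of_real t * x) = t * im x ;
  re_im_eq0 : forall x, re x = 0 -> im x = 0 -> x = 0 }.

Lemma real_scalars_real (R : realType) : real_scalars R R.
Proof.
exists idfun id id => //=; try by move=> x A.
by move=> t /andP[t0 t1]; rewrite ger0_norm.
Qed.

Lemma normc_real (R : realType) (x : R) : `|x%:C%C| = `|x|%:C%C.
Proof. by rewrite normc_def /= expr0n /= addr0 sqrtr_sqr. Qed.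

Lemma continuous_additive (R : realType) (F : numFieldType) (f : F -> R) :
  (forall x y, f (x - y) = f x - f y) ->
  (forall e : R, 0 < e ->
     exists2 d : F, 0 < d & forall x, `|x| < d -> `|f x| < e) ->
  continuous (f : F^o -> R).
Proof.
move=> fB f0 x A /nbhs_ballP[e /= e0 eA]; have [d d0 fd] := f0 e e0.
apply/(@nbhs_ballP F F^o); exists d => // y /= xy.
by apply: eA; rewrite -ball_normE /= -fB; exact: fd.
Qed.

Lemma real_scalars_complex (R : realType) : real_scalars R R[i].
Proof.
have lesq (a b : R) : `|a| <= Num.sqrt (a ^+ 2 + b ^+ 2).
  by rewrite -sqrtr_sqr ler_sqrt ?addr_ge0 ?sqr_ge0 // lerDl sqr_ge0.
have ReB : forall x y : R[i], complex.Re (x - y) = complex.Re x - complex.Re y.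
  by case=> [? ?] [? ?].
have ImB : forall x y : R[i], complex.Im (x - y) = complex.Im x - complex.Im y.
  by case=> [? ?] [? ?].
exists (real_complex R : {rmorphism R -> R[i]}) (@complex.Re R) (@complex.Im R) => //.
- move=> x; apply/(@cvgrPdist_lt _ R[i]^o) => e e0.
  (* A radius in [R[i]] is positive, hence real, so its real part serves as a radius in [R]. *)
  have e_real : e \is Num.real by rewrite gtr0_real.
  have -> : e = (complex.Re e)%:C%C by rewrite RRe_real.
  near=> y; rewrite -rmorphB normc_real ltcR.
  near: y; apply/nbhs_ballP; exists (complex.Re e) => //=.
  by rewrite -ltcR RRe_real.
- move=> t /andP[t0 t1]; rewrite normc_real -[1]/(1%:C%C) lecR ger0_norm //.
- apply: continuous_additive => // e e0; exists e%:C%C; first by rewrite ltcR.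
  by move=> x; rewrite normc_def ltcR; apply: le_lt_trans.
- apply: continuous_additive => // e e0; exists e%:C%C; first by rewrite ltcR.
  by move=> x; rewrite normc_def ltcR addrC; apply: le_lt_trans.
- by move=> t [a b] /=; rewrite mul0r subr0.
- by move=> t [a b] /=; rewrite mul0r addr0.
- by move=> [a b] /= -> ->.
Unshelve. all: by end_near. Qed.

Lemma real_scalars_exist (R : realType) (F : numFieldType) :
  F = R :> numFieldType \/ F = R[i] :> numFieldType -> inhabited (real_scalars R F).
Proof.
by case=> ->; constructor; [exact: real_scalars_real | exact: real_scalars_complex].
Qed.

(** [D] is the union of the images of the real segments from [x0] to its points; these are connected
    and all contain [x0]. *)
Lemma connected_star (R : realType) (F : numFieldType) (rs : real_scalars R F)
    (V : normedModType F) (D : set V) (x0 : V) :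
  D x0 ->
  (forall x (t : R), D x -> 0 <= t <= 1 -> D (x0 + of_real rs t *: (x - x0))) ->
  connected D.
Proof.
move=> Dx0 starD.
have -> : D = \bigcup_(x in D) ((fun t => x0 + of_real rs t *: (x - x0)) @` `[0, 1]).
  apply/seteqP; split=> [x Dx | x [y Dy [t] /=]].
    exists x => //; exists 1; first by rewrite /= in_itv /= ler01 lexx.
    by rewrite rmorph1 scale1r addrC subrK.
  by rewrite in_itv => /= t01 <-; exact: starD.
apply: bigcup_connected => [|x Dx].
  exists x0 => x Dx; exists 0; first by rewrite /= in_itv /= ler01 lexx.
  by rewrite rmorph0 scale0r addr0.
apply: connected_continuous_connected; first exact: segment_connected.
apply: continuous_subspaceT => t; apply: cvgD; first exact: cvg_cst.
by apply: cvgZr_tmp; exact: of_real_continuous.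
Qed.

(** * Functions with zero derivative *)

(** Taking only real multiples of [d] as increments turns the quotient over [F] into a real one,
    because [pr] is continuous and commutes with differences and real factors. *)
Lemma is_derive_projection (R : realType) (F : numFieldType)
    (rs : real_scalars R F) (pr : F -> R) (f : F^o -> F^o) (t d : F^o) (u : R) :
  continuous (pr : F^o -> R) -> (forall x y, pr (x - y) = pr x - pr y) ->
  (forall r x, pr (of_real rs r * x) = r * pr x) ->
  differentiable f (of_real rs u * d + t) ->
  'D_1 f (of_real rs u * d + t) = 0 ->
  is_derive u (1 : R) (fun r : R => pr (f (of_real rs r * d + t))) 0.
Proof.
move=> prC prB prZ; set x := of_real rs u * d + t => df Df0.
have pr0 : pr 0 = 0 by rewrite -[0 in LHS](subrr 0) prB subrr.
have Dd0 : 'D_d f x = 0.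
  rewrite deriveE // -[d]mulr1 -[d * 1]/(d *: (1 : F^o)) linearZ /= -deriveE //.
  by rewrite Df0 scaler0.
have quot : h^-1 *: (f (h *: d + x) - f x) @[h --> (0 : F^o)^'] --> 'D_d f x.
  exact: (@diff_derivable _ _ _ f x d df).
rewrite Dd0 in quot.
(* The embedding is continuous and injective, so nonzero real increments tending to 0 remain nonzero
   and tend to 0 in [F]. *)
have iota0 : of_real rs h @[h --> (0 : R)^'] --> (0 : F^o)^'.
  move=> A A0.
  have B0 : \forall h \near (0 : R), of_real rs h != 0 -> A (of_real rs h).
    by apply: (@of_real_continuous _ _ rs 0 [set y | y != 0 -> A y]); rewrite rmorph0.
  suff : \forall h \near (0 : R)^', A (of_real rs h) by [].
  rewrite /dnbhs near_withinE; apply: filterS B0 => h Ah h0.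
  by apply: Ah; rewrite fmorph_eq0.
have lim : h^-1 *: (pr (f (of_real rs (h *: 1 + u) * d + t)) - pr (f x))
    @[h --> (0 : R)^'] --> (0 : R).
  have := cvg_comp _ _ iota0 quot => /(cvg_comp _ _) /(_ (prC 0)); rewrite pr0.
  apply: cvg_trans; apply: near_eq_cvg; near=> h => /=.
  have h0 : h != 0 by near: h; exact: nbhs_dnbhs_neq.
  apply: (mulfI h0); rewrite -prZ /GRing.scale /= mulVKf ?fmorph_eq0 // prB mulr1.
  by rewrite mulVKf // rmorphD mulrDl addrA.
by apply: DeriveDef; [apply/cvg_ex; exists 0 | apply/cvg_lim].
Unshelve. all: by end_near. Qed.

(** The mean value theorem fails for complex values, so it is applied along the segment to the
    projections [re] and [im] of [f]; [re_im_eq0] recombines them. *)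
Lemma zero_derive_segment (R : realType) (F : numFieldType)
    (rs : real_scalars R F) (f : F^o -> F^o) (s t : F^o) :
  (forall u : R, 0 <= u <= 1 ->
     differentiable f (of_real rs u * (s - t) + t) /\
     'D_1 f (of_real rs u * (s - t) + t) = 0) ->
  f s = f t.
Proof.
move=> f0.
have pr_eq (pr : F -> R) : continuous (pr : F^o -> R) ->
    (forall x y, pr (x - y) = pr x - pr y) ->
    (forall r x, pr (of_real rs r * x) = r * pr x) -> pr (f s - f t) = 0.
  move=> prC prB prZ; pose g (r : R) := pr (f (of_real rs r * (s - t) + t)).
  have dg (u : R) : u \in `[0, 1] -> is_derive u (1 : R) g 0.
    rewrite in_itv /= => /f0[df Df].
    exact: (@is_derive_projection R F rs pr f t (s - t) u prC prB prZ df Df).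
  have gC : {within `[0, 1], continuous g}.
    by apply: derivable_within_continuous => u /dg[].
  have dg' (u : R) : u \in `]0, 1[ -> is_derive u (1 : R) g (cst 0 u).
    by move=> u01; apply: dg; exact: subset_itv_oo_cc u01.
  have [c _] := MVT_segment ler01 dg' gC.
  by rewrite /g rmorph0 rmorph1 !mul0r mul1r add0r subrK prB.
apply/eqP; rewrite -subr_eq0; apply/eqP; apply: (re_im_eq0 (r := rs)).
- by apply: pr_eq; [exact: re_continuous | exact: re_sub | exact: re_scale].
- by apply: pr_eq; [exact: im_continuous | exact: im_sub | exact: im_scale].
Qed.

(** The points of [I] where [f] takes the value [f t] and those where it does not both form open
    sets, so the first set is open and closed relative to [I]. *)
Lemma locally_constant_connected (T : topologicalType) (U : Type) (I : set T)
    (f : T -> U) :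
  open I -> connected I ->
  (forall t, I t -> \forall s \near t, f s = f t) ->
  forall s t, I s -> I t -> f s = f t.
Proof.
move=> Iop Ic floc s t Is It.
have level_open (P : U -> Prop) : open [set x | I x /\ P (f x)].
  rewrite openE => x [Ix Px]; near=> y; split; first by near: y; exact: open_nbhs_nbhs.
  by rewrite (near (floc x Ix) y).
have : [set x | I x /\ f x = f t] = I.
  apply: Ic; first by exists t.
  - exists [set x | I x /\ f x = f t]; first exact: (level_open (fun u => u = f t)).
    by apply/seteqP; split=> x; [move=> [] | case].
  - exists (~` [set x | I x /\ f x <> f t]).
      by apply: open_closedC; exact: (level_open (fun u => u <> f t)).
    apply/seteqP; split=> x /=; first by case=> Ix fx; split=> // -[].
    by case=> Ix nfx; split=> //; apply: contrapT => fx; exact: nfx.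
by move/seteqP => -[_ /(_ s Is)[]].
Unshelve. all: by end_near. Qed.

(** Segments may leave [I], but a ball around a point of [I] contains the segments to its centre;
    hence [f] is locally constant, and connectedness does the rest. *)
Lemma zero_derive_connected (R : realType) (F : numFieldType)
    (rs : real_scalars R F) (I : set F^o) (f : F^o -> F^o) :
  open I -> connected I ->
  (forall t, I t -> differentiable f t /\ 'D_1 f t = 0) ->
  forall s t, I s -> I t -> f s = f t.
Proof.
move=> Iop Ic f0; apply: locally_constant_connected => // t It.
have /nbhs_ballP[e /= e0 eI] := open_nbhs_nbhs (conj Iop It).
apply/nbhs_ballP; exists e => // s; rewrite -ball_normE /= distrC => ts.
apply: (zero_derive_segment (rs := rs)) => u u01.
apply: f0; apply: eI; rewrite -ball_normE /= opprD addrCA subrr addr0 normrN normrM.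
by apply: le_lt_trans ts; rewrite ler_piMl // norm_of_real_le1.
Qed.

(** * The model webs *)

Definition poly_y (F : numFieldType) (p : {poly F}) : 'rV[F]_2 -> F^o :=
  fun x => p.[x 0 1].

Lemma is_derive_poly_y (F : numFieldType) (p : {poly F}) (x u : 'rV[F]_2) :
  differentiable (poly_y p) x /\ 'D_u (poly_y p) x = u 0 1 * p^`().[x 0 1].
Proof.
have dy : differentiable (fun x : 'rV[F]_2 => x 0 1 : F^o) x.
  exact: differentiable_coord.
have Dy : 'D_u (fun x : 'rV[F]_2 => x 0 1 : F^o) x = u 0 1.
  by apply: (@derive_quadratic _ _ F^o _ _ _ _ 0) => h; rewrite !mxE scaler0 addr0 addrC.
elim/poly_ind: p => [|p c [dp Dp]].
  have -> : poly_y 0 = cst 0 :> ('rV[F]_2 -> F^o).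
    by apply/funext => y; rewrite /poly_y horner0.
  by split; [exact: differentiable_cst | rewrite derive_cst deriv0 horner0 mulr0].
have -> : poly_y (p * 'X + c%:P) = (poly_y p * (fun x => x 0 1)) + cst c.
  by apply/funext => y; rewrite /poly_y !hornerE.
have dpy : differentiable (poly_y p * (fun x : 'rV[F]_2 => x 0 1)) x.
  exact: differentiableM.
split; first by apply: differentiableD => //; exact: differentiable_cst.
rewrite deriveD; [|exact: diff_derivable|exact: diff_derivable].
rewrite deriveM; [|exact: diff_derivable|exact: diff_derivable].
rewrite derive_cst Dp Dy derivD derivM derivX derivC !hornerE /GRing.scale /=.
by rewrite /poly_y; ring.
Qed.

(** This family of maps is stable under directional derivatives: the direction [u] replaces each
    polynomial by its derivative times the second coordinate of [u]. *)
Lemma smooth_on_poly_y (F : numFieldType) (W : normedModType F)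
    (D : set 'rV[F]_2) (P Q : {poly F}) (e1 e2 : W) :
  smooth_on D (fun x => poly_y P x *: e1 + poly_y Q x *: e2).
Proof.
have diff_term (R : {poly F}) (e : W) x : differentiable (fun x => poly_y R x *: e) x.
  exact: (differentiableZl _ (is_derive_poly_y R x 0).1).
have D_term (R : {poly F}) (e : W) x u :
    'D_u (fun x => poly_y R x *: e) x = poly_y (u 0 1 *: R^`()) x *: e.
  have [dR DR] := is_derive_poly_y R x u.
  have dS : differentiable (fun k : F^o => k *: e) (poly_y R x) by exact: ex_diff.
  rewrite (@derive_comp _ _ F^o _ (fun k : F^o => k *: e) (poly_y R)) // DR.
  apply: (@derive_quadratic F F^o W (fun k : F^o => k *: e) _ _ _ 0) => h.
  by rewrite scaler0 addr0 scalerDl addrC /poly_y hornerZ -scalerA.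
move=> us x Dx.
have [P' [Q' ->]] : exists P' Q', foldr (fun u (g : 'rV[F]_2 -> W) => 'D_u g)
    (fun x => poly_y P x *: e1 + poly_y Q x *: e2) us =
    (fun x => poly_y P' x *: e1 + poly_y Q' x *: e2).
  elim: us => [|u us [P' [Q' IHus]]] /=; first by exists P, Q.
  exists (u 0 1 *: P'^`()), (u 0 1 *: Q'^`()); rewrite IHus.
  apply/funext => y; rewrite deriveD ?D_term //; exact: diff_derivable.
exact: differentiableD.
Qed.

Definition model_dx (F : numFieldType) (m : foliation) : F :=
  match m with X2 => 0 | _ => 1 end.

Definition model_prim (F : numFieldType) (m : foliation) : {poly F} :=
  match m with X1 => 0 | X2 => 'X | X3 => 'X^2 | X4 => 'X end.

(* The divided difference of model_prim. *)
Definition model_slope (F : numFieldType) (m : foliation) (y y' : F) : F :=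
  match m with X1 => 0 | X2 => 1 | X3 => y + y' | X4 => 1 end.

Definition model_integral (F : numFieldType) (m : foliation) : 'rV[F]_2 -> F^o :=
  fun x => model_dx F m * x 0 0 + (model_prim F m).[x 0 1].

Definition model_form (F : numFieldType) (m : foliation) (x : 'rV[F]_2) : 'cV[F]_2 :=
  model_dx F m *: delta_mx 0 0 + (model_prim F m)^`().[x 0 1] *: delta_mx 1 0.

(** Sums of two values of y avoid 0 and 1 here. This separates the divided difference y + y' of y^2
    from the slopes 0 and 1 of the first integrals x and x + y. *)
Definition model_domain (F : numFieldType) : set 'rV[F]_2 :=
  [set x | `|x 0 1 - 2| < 1].

(* The leaves of X in the web attached to c are the level curves of
   model_integral (role c X); since a must be a function of the first
   integral y of X_c, role c c = X2. *)
Definition role (c X : foliation) : foliation :=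
  match c, X with
  | X1, X1 => X2 | X1, X2 => X1 | X1, X3 => X4 | X1, X4 => X3
  | X2, _ => X
  | X3, X1 => X1 | X3, X2 => X3 | X3, X3 => X2 | X3, X4 => X4
  | X4, X1 => X3 | X4, X2 => X4 | X4, X3 => X1 | X4, X4 => X2
  end.

(* The multiples making the sum of the first three forms vanish and a equal
   to 2 y (1 - 2 y for c = X3). *)
Definition factor (F : numFieldType) (c X : foliation) : {poly F} :=
  match c, X with
  | X1, X1 | X1, X2 => 1 | X1, X3 | X1, X4 => -1
  | X2, X1 => 1 | X2, X2 => 2 *: 'X | X2, X3 => -1 | X2, X4 => - (2 *: 'X)
  | X3, X1 => 1 | X3, X2 => -1 | X3, X3 => 2 *: 'X | X3, X4 => 2 *: 'X
  | X4, X1 => 1 | X4, X2 => - (2 *: 'X) | X4, X3 => 2 *: 'X - 1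
  | X4, X4 => - (2 *: 'X * (2 *: 'X - 1))
  end.

Definition web_form (F : numFieldType) (c X : foliation) (x : 'rV[F]_2) : 'cV[F]_2 :=
  (factor F c X).[x 0 1] *: model_form (role c X) x.

Definition web_invariant (F : numFieldType) (c : foliation) : {poly F} :=
  if c is X3 then 1 - 2 *: 'X else 2 *: 'X.

Lemma smooth_poly_y (F : numFieldType) (D : set 'rV[F]_2) (p : {poly F}) :
  smooth_on D (poly_y p).
Proof.
have -> : poly_y p = (fun x => poly_y p x *: (1 : F^o) + poly_y 0 x *: (0 : F^o)).
  by apply/funext => x; rewrite scaler0 addr0 [RHS]mulr1.
exact: smooth_on_poly_y.
Qed.

Lemma smooth_web_form (F : numFieldType) (D : set 'rV[F]_2) (c X : foliation) :
  smooth_on D (@web_form F c X).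
Proof.
pose m := role c X; pose P := factor F c X * (model_dx F m)%:P.
have -> : @web_form F c X = (fun x => poly_y P x *: (delta_mx 0 0 : 'cV_2)
    + poly_y (factor F c X * (model_prim F m)^`()) x *: delta_mx 1 0).
  apply/funext => x.
  by rewrite /web_form /model_form scalerDr !scalerA /poly_y !hornerM hornerC.
exact: smooth_on_poly_y.
Qed.

(** * Transversality and intersections of the model leaves *)

(** The sum lies at distance less than 2 from 4, while [k] lies at distance at least 2 from it. *)
Lemma model_domain_sum (F : numFieldType) (x x' : 'rV[F]_2) (k : nat) :
  model_domain x -> model_domain x' -> (k <= 2)%N -> x 0 1 + x' 0 1 != k%:R.
Proof.
rewrite /model_domain /= => Dx Dx' k2; apply/eqP => xk.
have := le_lt_trans (ler_normD _ _) (ltrD Dx Dx').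
have -> : x 0 1 - 2 + (x' 0 1 - 2) = - (4 - k)%:R.
  by rewrite natrB ?(leq_trans k2) // -xk; ring.
by rewrite normrN normr_nat -(natrD _ 1 1) ltr_nat; case: k k2 {xk} => [|[|[|]]].
Qed.

Lemma model_domain_neq0 (F : numFieldType) (x : 'rV[F]_2) :
  model_domain x -> 2 * x 0 1 != 0 /\ 2 * x 0 1 - 1 != 0.
Proof.
move=> Dx; rewrite subr_eq0 mulr_natl mulr2n.
by split; [exact: (@model_domain_sum _ _ _ 0) | exact: (@model_domain_sum _ _ _ 1)].
Qed.

(** This is the determinant of the linear system for the coordinate differences of two points lying
    on the same two leaves. For [x = x'] it is the Jacobian, so it also yields transversality. *)
Lemma model_slope_neq (F : numFieldType) (m m' : foliation) (x x' : 'rV[F]_2) :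
  model_domain x -> model_domain x' -> m <> m' ->
  model_dx F m * model_slope m' (x 0 1) (x' 0 1)
  - model_dx F m' * model_slope m (x 0 1) (x' 0 1) != 0.
Proof.
move=> Dx Dx'.
have /= s0 := model_domain_sum Dx Dx' (isT : 0 <= 2)%N.
have /= s1 := model_domain_sum Dx Dx' (isT : 1 <= 2)%N.
by case: m; case: m' => // _ /=;
  rewrite ?mulr1 ?mul1r ?mul0r ?mulr0 ?subr0 ?sub0r ?oppr_eq0 ?oner_eq0 // subr_eq0 // eq_sym.
Qed.

Lemma model_prim_slope (F : numFieldType) (m : foliation) (y y' : F) :
  (model_prim F m).[y] - (model_prim F m).[y'] = (y - y') * model_slope m y y'.
Proof. by case: m => /=; rewrite !hornerE //; ring. Qed.

Lemma model_prim_deriv (F : numFieldType) (m : foliation) (y : F) :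
  (model_prim F m)^`().[y] = model_slope m y y.
Proof.
by case: m => /=; rewrite ?derivXn ?derivX ?deriv0 ?hornerMn ?hornerE /= ?mulr2n.
Qed.

(** Divided differences turn the two equalities into a homogeneous linear system in the coordinate
    differences, solved by Cramer's rule. *)
Lemma model_integrals_inj (F : numFieldType) (m m' : foliation) (x x' : 'rV[F]_2) :
  model_domain x -> model_domain x' -> m <> m' ->
  model_integral m x = model_integral m x' ->
  model_integral m' x = model_integral m' x' -> x = x'.
Proof.
move=> Dx Dx' mm' /eqP; rewrite /model_integral -subr_eq0.
set a := model_dx F m; set b := model_dx F m'.
have -> : a * x 0 0 + (model_prim F m).[x 0 1] - (a * x' 0 0 + (model_prim F m).[x' 0 1])
  = a * (x 0 0 - x' 0 0) + ((model_prim F m).[x 0 1] - (model_prim F m).[x' 0 1]) by ring.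
rewrite model_prim_slope => /eqP e1 /eqP; rewrite -subr_eq0.
have -> : b * x 0 0 + (model_prim F m').[x 0 1] - (b * x' 0 0 + (model_prim F m').[x' 0 1])
  = b * (x 0 0 - x' 0 0) + ((model_prim F m').[x 0 1] - (model_prim F m').[x' 0 1]) by ring.
rewrite model_prim_slope => /eqP e2.
have det0 := model_slope_neq Dx Dx' mm'; rewrite -/a -/b in det0.
move: e1 e2 det0; set s := model_slope m _ _; set s' := model_slope m' _ _ => e1 e2 det0.
have x0 : x 0 0 = x' 0 0.
  apply/eqP; rewrite -subr_eq0 -(mulIr_eq0 _ (mulIf det0)).
  have -> : (x 0 0 - x' 0 0) * (a * s' - b * s) =
    s' * (a * (x 0 0 - x' 0 0) + (x 0 1 - x' 0 1) * s)
    - s * (b * (x 0 0 - x' 0 0) + (x 0 1 - x' 0 1) * s') by ring.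
  by rewrite e1 e2 !mulr0 subr0.
have x1 : x 0 1 = x' 0 1.
  apply/eqP; rewrite -subr_eq0 -(mulIr_eq0 _ (mulIf det0)).
  have -> : (x 0 1 - x' 0 1) * (a * s' - b * s) =
    a * (b * (x 0 0 - x' 0 0) + (x 0 1 - x' 0 1) * s')
    - b * (a * (x 0 0 - x' 0 0) + (x 0 1 - x' 0 1) * s) by ring.
  by rewrite e1 e2 !mulr0 subr0.
apply/rowP => i; case: (unliftP 0 i) => [j|] ->; last exact: x0.
by rewrite (ord1 j) (_ : lift 0 0 = 1) //; apply/val_inj.
Qed.

Lemma factor_neq0 (F : numFieldType) (c X : foliation) (x : 'rV[F]_2) :
  model_domain x -> (factor F c X).[x 0 1] != 0.
Proof.
move=> /model_domain_neq0[y0 y1].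
by case: c; case: X => /=; rewrite !hornerE ?oppr_eq0 ?oner_eq0 ?(mulf_neq0 y0 y1) .
Qed.

Lemma role_inj (c : foliation) : injective (role c).
Proof. by case: c => -[] []. Qed.

Lemma derive_model_integral (F : numFieldType) (m : foliation) (x u : 'rV[F]_2) :
  differentiable (@model_integral F m) x /\
  u *m model_form m x = ('D_u (@model_integral F m) x)%:M.
Proof.
have dx : differentiable (fun x : 'rV[F]_2 => x 0 0 : F^o) x.
  exact: differentiable_coord.
have [dp Dp] := is_derive_poly_y (model_prim F m) x u.
have -> : @model_integral F m =
    (model_dx F m \*: (fun x : 'rV[F]_2 => x 0 0 : F^o)) + poly_y (model_prim F m) by [].
have dax : differentiable (model_dx F m \*: (fun x : 'rV[F]_2 => x 0 0 : F^o)) x.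
  exact: differentiableZ.
split; first exact: differentiableD.
rewrite deriveD; [|exact: diff_derivable|exact: diff_derivable].
have -> : 'D_u (model_dx F m \*: (fun x : 'rV[F]_2 => x 0 0 : F^o)) x = model_dx F m * u 0 0.
  apply: (@derive_quadratic _ _ F^o _ _ _ _ 0) => h.
  change (model_dx F m * (h *: u + x) 0 0 =
    model_dx F m * x 0 0 + h * (model_dx F m * u 0 0) + h ^+ 2 * 0).
  by rewrite !mxE; ring.
apply/rowP => i; rewrite (ord1 i) Dp !mxE !big_ord_recl big_ord0 !mxE /=.
rewrite (_ : lift 0 0 = 1); last exact/val_inj.
by rewrite /=; ring.
Qed.

(** The derivative of the first integral along the curve is the velocity paired with [model_form],
    and [web_form] is a nonzero multiple of that form. *)
Lemma model_integral_constant (R : realType) (F : numFieldType)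
    (rs : real_scalars R F) (c X : foliation) (I : set F^o) (g : F^o -> 'rV[F]_2) :
  integral_curve (@model_domain F) (@web_form F c X) I g ->
  forall s t, I s -> I t ->
    model_integral (role c X) (g s) = model_integral (role c X) (g t).
Proof.
case=> Iop Ic gS gD gt; apply: (zero_derive_connected rs Iop Ic) => t It.
have dg : differentiable g t := gS [::] t It.
have [df Df] := derive_model_integral (role c X) (g t) ('D_1 g t).
split; first exact: differentiable_comp.
rewrite derive_comp //.
have [_] := gt t It; rewrite /web_form -scalemxAr Df => /eqP.
rewrite scaler_eq0 (negbTE (factor_neq0 _ _ _)) /=; last exact/gD/imageP.
by move=> /eqP/rowP/(_ 0); rewrite !mxE eqxx mulr1n.
Qed.

Lemma det_row_mx2 (F : numFieldType) (A B : 'cV[F]_2) :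
  \det (row_mx A B) = A 0 0 * B 1 0 - B 0 0 * A 1 0.
Proof.
have E0 i (j : 'I_(1 + 1)) : j = 0%N :> nat -> row_mx A B i j = A i 0.
  by move=> j0; rewrite (_ : j = lshift 1 0) ?row_mxEl //; exact/val_inj.
have E1 i (j : 'I_(1 + 1)) : j = 1%N :> nat -> row_mx A B i j = B i 0.
  by move=> j1; rewrite (_ : j = rshift 1 0) ?row_mxEr //; exact/val_inj.
move: (row_mx A B) E0 E1 => M E0 E1.
rewrite (expand_det_row _ 0) big_ord_recl big_ord_recl big_ord0 /cofactor !det_mx11 !mxE.
rewrite [M _ 0]E0 // ![M _ (lift 0 0)]E1 // [M _ _]E0 // (_ : lift 0 0 = 1); last exact/val_inj.
by rewrite /= expr0 expr1 mul1r mulN1r mulrN addr0.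
Qed.

(** Once the nonzero factors are pulled out, the determinant is the case [x = x'] of
    [model_slope_neq]. *)
Lemma web_form_independent (F : numFieldType) (c X Y : foliation) (x : 'rV[F]_2) :
  X <> Y -> model_domain x ->
  row_mx (web_form c X x) (web_form c Y x) \in unitmx.
Proof.
move=> XY Dx; rewrite unitmxE unitfE det_row_mx2 !mxE !model_prim_deriv.
rewrite !mulr1 !mulr0 !addr0 !add0r mulrACA [X in _ - X]mulrACA.
rewrite [(factor F c Y).[_] * _]mulrC -mulrBr mulf_neq0 //.
  by rewrite mulf_neq0 ?factor_neq0.
by apply: model_slope_neq => // /role_inj.
Qed.

Lemma exists_web_constant_on_leaves (R : realType) (F : numFieldType)
    (rs : real_scalars R F) (c : foliation) :
  exists (D : set 'rV[F]_2) (w : foliation -> 'rV[F]_2 -> 'cV[F]_2)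
      (a : 'rV[F]_2 -> F^o),
    [/\ is_4web D w a, constant_on_leaves D (w c) a
      & exists x y, [/\ D x, D y & a x != a y]].
Proof.
exists (@model_domain F), (@web_form F c), (poly_y (web_invariant F c)); split.
- split.
  + split.
    * rewrite (_ : @model_domain F =
          (fun x : 'rV[F]_2 => x 0 1 : F^o) @^-1` ball (2 : F^o) 1).
        apply: open_comp; last exact: ball_open.
        by move=> x _; exact: coord_continuous.
      by apply/seteqP; split=> x; rewrite /model_domain -ball_normE /= distrC.
    (* The domain is star-shaped about the point (2, 2). *)
    * apply: (connected_star (rs := rs) (x0 := const_mx 2)).
        by rewrite /model_domain /= mxE subrr normr0.
      move=> x t Dx t01; rewrite /model_domain /= !mxE addrAC subrr add0r normrM.
      by apply: le_lt_trans Dx; rewrite ler_piMl // norm_of_real_le1.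
    * by exists (const_mx 2); rewrite /model_domain /= mxE subrr normr0.
  + by split=> [|X]; [exact: smooth_poly_y | exact: smooth_web_form].
  + move=> x _; rewrite /web_form /model_form /poly_y.
    split; apply/colP => i; case: c; rewrite !mxE /= ?poly.derivE ?hornerE /=; ring.
  + move=> X Y x; exact: web_form_independent.
  + move=> X Y I J g h XY gI hJ x y [s Is <-] [s' Js' hs'] [t It <-] [t' Jt' ht'].
    case: (gI) => _ _ _ gD _.
    (* At [x] and [y] both first integrals take the same values, and these determine a point of the
       domain. *)
    apply: (@model_integrals_inj _ (role c X) (role c Y)).
    * exact/gD/imageP.
    * exact/gD/imageP.
    * by move/role_inj.
    * exact: (model_integral_constant rs gI).
    * by rewrite -hs' -ht'; exact: (model_integral_constant rs hJ).
- move=> I g gI s t Is It.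
  have := model_integral_constant rs gI Is It.
  (* The first integral of X_c is therefore y, and the invariant is a polynomial in y. *)
  rewrite (_ : role c c = X2); last by case: c {gI}.
  by rewrite /model_integral /= !hornerX !mul0r !add0r /poly_y => ->.
(* The invariant differs at y = 2 and y = 5/2, so the web is not one with constant invariant. *)
- exists (const_mx 2), (const_mx (2 + 2^-1)); split.
  + by rewrite /model_domain /= mxE subrr normr0.
  + rewrite /model_domain /= mxE addrAC subrr add0r normfV normr_nat.
    by rewrite invf_lt1 ?ltr1n ?ltr0n.
  + rewrite /poly_y !mxE -subr_eq0.
    by case: c => /=; rewrite !hornerE.
Qed.

(** * Cartan's test *)

(** Rank-nullity for the map listing the values of the forms. Its surjectivity expresses their
    independence and turns the inequality into an equality. *)
Lemma kernel_codim (K : fieldType) (V : vectType K) (ls : seq (V -> K)) :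
  (forall i, scalar (nth (fun=> 0) ls i)) ->
  exists H : {vspace V},
    [/\ forall v, v \in H <->
          forall i, (i < size ls)%N -> nth (fun=> 0) ls i v = 0,
        (\dim {:V} <= \dim H + size ls)%N
      & (forall y : nat -> K, exists v,
           forall i, (i < size ls)%N -> nth (fun=> 0) ls i v = y i) ->
        (\dim H + size ls)%N = \dim {:V}].
Proof.
move=> lin.
pose f v : 'rV[K]_(size ls) := \row_i nth (fun=> 0) ls i v.
have f_lin : linear f by move=> a u v; apply/rowP => i; rewrite !mxE lin.
pose fM := GRing.isLinear.Build _ _ _ _ f f_lin.
pose fL : {linear V -> 'rV[K]_(size ls)} := HB.pack f fM.
have dimE := limg_ker_dim (linfun fL) fullv.
rewrite capfv in dimE.
have dim_row : \dim {:'rV[K]_(size ls)} = size ls by rewrite dimvf /dim /= mul1n.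
exists (lker (linfun fL)); split.
- move=> v; rewrite memv_ker lfunE /= /f; split.
    by move=> /eqP/rowP fv0 i i_lt; have := fv0 (Ordinal i_lt); rewrite !mxE.
  by move=> fv0; apply/eqP/rowP => i; rewrite !mxE fv0.
- by rewrite -dimE leq_add2l -[X in (_ <= X)%N]dim_row dimvS ?subvf.
- move=> surj; rewrite -dimE -[X in (_ + X)%N = _]dim_row; congr (_ + \dim _)%N.
  apply/eqP; rewrite eqEsubv subvf andbT; apply/subvP => y _.
  have [v vE] := surj (fun i => if insub i is Some j then y 0 j else 0).
  apply/memv_imgP; exists v; first exact: memvf.
  by rewrite lfunE; apply/rowP => i; rewrite mxE vE // valK.
Qed.

Lemma mem_graph_plane (F : numFieldType) (n N : nat) (p : 'M[F]_(n, N)) v :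
  v \in graph_plane p <-> rsubmx v = lsubmx v *m p.
Proof.
split.
  pose f (v : 'rV[F]_(n + N)) := rsubmx v - lsubmx v *m p.
  have f_lin : linear f.
    by move=> a x y; rewrite /f !linearP /= mulmxDl -scalemxAl scalerBr opprD addrACA.
  pose fM := GRing.isLinear.Build _ _ _ _ f f_lin.
  pose fL : {linear 'rV[F]_(n + N) -> 'rV[F]_N} := HB.pack f fM.
  suff /subvP/[apply] : (graph_plane p <= lker (linfun fL))%VS.
    by rewrite memv_ker lfunE /= subr_eq0 => /eqP.
  apply/span_subvP => _ /mapP[i _ ->]; rewrite memv_ker lfunE /= /f.
  by rewrite row_row_mx row_mxKr row_mxKl -row_mul mul1mx subrr.
move=> vE; have -> : v = lsubmx v *m row_mx 1%:M p.
  by rewrite mul_mx_row mulmx1 -vE hsubmxK.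
rewrite mulmx_sum_row; apply: memv_suml => i _; apply/memvZ/memv_span/map_f.
exact: mem_enum.
Qed.

(* kphi and aphi are the two Pfaffian forms; kpi1, kpi2 and api are the forms
   pi1, pi2 and pi3. *)
Definition kphi (F : numFieldType) (z : 'rV[F]_5) (v : 'rV[F]_(3 + 5)) : F :=
  dK v - 2 * vK z * theta v - (vK1 z * w1 v + vK2 z * w2 v).

Definition aphi (F : numFieldType) (c : foliation) (z : 'rV[F]_5)
    (v : 'rV[F]_(3 + 5)) : F :=
  da v - vb z * leaf_form c z v.

Definition kpi1 (F : numFieldType) (z : 'rV[F]_5) (v : 'rV[F]_(3 + 5)) : F :=
  rsubmx v 0 2 - 3 * vK1 z * theta v.

Definition kpi2 (F : numFieldType) (z : 'rV[F]_5) (v : 'rV[F]_(3 + 5)) : F :=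
  rsubmx v 0 3 - 3 * vK2 z * theta v + 2 * vK z ^+ 2 * w1 v.

Definition api (F : numFieldType) (c : foliation) (z : 'rV[F]_5)
    (v : 'rV[F]_(3 + 5)) : F :=
  rsubmx v 0 4 - vb z * theta v - (if c is X4 then vb z ^+ 2 * w1 v else 0).

(** * Exterior derivatives of the equations *)

Lemma web_bracket (F : numFieldType) (c : foliation) (z : 'rV[F]_5) u v :
  let b := bracket (web_system F c) z u v in
  [/\ w1 b = - wedge (@w1 F) (@theta F) u v, w2 b = - wedge (@w2 F) (@theta F) u v,
      theta b = - (vK z * wedge (@w1 F) (@w2 F) u v), dK b = 0 & da b = 0].
Proof.
by rewrite /= /bracket /w1 /w2 /theta /dK /da !row_mxKl !row_mxKr !mxE.
Qed.

(** The hypotheses allow replacing dK by 2 K theta + K1 w1 + K2 w2. The factor 3 in [kpi1] and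
    [kpi2] is 2 from dK /\ theta plus 1 from dw_i = w_i /\ theta; the term 2 K^2 w1 comes from 2 K
    dtheta. *)
Lemma ext_d1_kphi (F : numFieldType) (c : foliation) (z : 'rV[F]_5) u v :
  kphi z u = 0 -> kphi z v = 0 ->
  ext_d1 (web_system F c) (@kphi F) z u v
  = - (wedge (kpi1 z) (@w1 F) u v + wedge (kpi2 z) (@w2 F) u v).
Proof.
have D x y : 'D_(rsubmx x) (fun z => kphi z y : F^o) z
    = - 2 * dK x * theta y - (rsubmx x 0 2 * w1 y + rsubmx x 0 3 * w2 y).
  rewrite /dK; move: (rsubmx x) => d.
  apply: (@derive_quadratic _ _ F^o _ _ _ _ 0) => h.
  by rewrite /GRing.scale /= /kphi /vK /vK1 /vK2 !mxE; ring.
move=> /eqP; rewrite /kphi -addrA -opprD subr_eq0 => /eqP eu.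
move=> /eqP; rewrite /kphi -addrA -opprD subr_eq0 => /eqP ev.
rewrite /ext_d1 !D eu ev /kphi; case: (web_bracket c z u v) => -> -> -> -> _.
by rewrite /wedge /kpi1 /kpi2; ring.
Qed.

(** For [X4] the form lambda involves a, so b dlambda contains b da /\ w1; substituting da = b
    lambda produces the b^2 w1 of [api]. *)
Lemma ext_d1_aphi (F : numFieldType) (c : foliation) (z : 'rV[F]_5) u v :
  aphi c z u = 0 -> aphi c z v = 0 ->
  ext_d1 (web_system F c) (@aphi F c) z u v
  = - wedge (api c z) (leaf_form c z) u v.
Proof.
have D x y : 'D_(rsubmx x) (fun z => aphi c z y : F^o) z
    = - (rsubmx x 0 4 * leaf_form c z y)
      - (if c is X4 then vb z * da x * w1 y else 0).
  rewrite /da; move: (rsubmx x) => d.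
  (* For [X4] the coefficient of [w1] contains the product of b and a, whose increment has this
     second-order term. *)
  apply: (@derive_quadratic _ _ F^o _ _ _ _
    (if c is X4 then - (d 0 4 * d 0 1 * w1 y) else 0)) => h.
  by rewrite /GRing.scale /= /aphi /vb; case: c; rewrite /leaf_form /va !mxE; ring.
move=> /eqP; rewrite /aphi subr_eq0 => /eqP eu.
move=> /eqP; rewrite /aphi subr_eq0 => /eqP ev.
rewrite /ext_d1 !D eu ev /aphi; case: (web_bracket c z u v) => b1 b2 _ _ ->.
rewrite /wedge /api.
by case: c {D eu ev} b1 b2 => b1 b2 /=; rewrite ?b1 ?b2 /wedge; ring.
Qed.

(** For w1 and w2 a form is repeated in each product. For theta, dK /\ w1 /\ w2 = 2 K theta /\ w1 /\
    w2 cancels against K d(w1 /\ w2). *)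
Lemma ddcoframe_eq0 (F : numFieldType) (c : foliation) (z : 'rV[F]_5) i u v w :
  kphi z u = 0 -> kphi z v = 0 -> kphi z w = 0 ->
  ddcoframe (web_system F c) z i u v w = 0.
Proof.
move=> /eqP; rewrite /kphi -addrA -opprD subr_eq0 => /eqP eu.
move=> /eqP; rewrite /kphi -addrA -opprD subr_eq0 => /eqP ev.
move=> /eqP; rewrite /kphi -addrA -opprD subr_eq0 => /eqP ew.
have Dcst (k : F) d : 'D_d (fun _ : 'rV[F]_5 => k : F^o) z = 0.
  exact: derive_cst.
have DK (k : F) x : 'D_(rsubmx x) (fun z => vK z * k : F^o) z = dK x * k.
  rewrite /dK; move: (rsubmx x) => d.
  apply: (@derive_quadratic _ _ F^o _ _ _ _ 0) => h.
  by rewrite /GRing.scale /= /vK !mxE; ring.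
have [uv1 uv2 uv3 _ _] := web_bracket c z u v.
have [vw1 vw2 vw3 _ _] := web_bracket c z v w.
have [wu1 wu2 wu3 _ _] := web_bracket c z w u.
case: i => [[|[|[|//]]]] i_lt; rewrite /ddcoframe /ext_d2 /= ?Dcst ?DK ?eu ?ev ?ew;
  by rewrite /wedge ?uv1 ?uv2 ?uv3 ?vw1 ?vw2 ?vw3 ?wu1 ?wu2 ?wu3 /wedge; ring.
Qed.

Lemma pfaff1_web (F : numFieldType) (c : foliation) phi :
  pfaff1 (web_system F c) phi <-> phi = @kphi F \/ phi = @aphi F c.
Proof.
split; first by case=> [[|[|//]]] _ ->; [left | right].
by case=> ->; [exists 0%N | exists 1%N].
Qed.

(** * Integral elements *)

(** With the coefficients of lambda named, one computation covers the four foliations. *)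
Definition leaf1 (F : numFieldType) (c : foliation) (z : 'rV[F]_5) : F :=
  match c with X1 => 1 | X2 => 0 | X3 => 1 | X4 => va z end.

Definition leaf2 (F : numFieldType) (c : foliation) : F :=
  if c is X1 then 0 else 1.

Definition api_shift (F : numFieldType) (c : foliation) (z : 'rV[F]_5) : F :=
  if c is X4 then vb z ^+ 2 else 0.

Lemma leaf_formE (F : numFieldType) (c : foliation) (z : 'rV[F]_5) v :
  leaf_form c z v = leaf1 c z * w1 v + leaf2 F c * w2 v.
Proof. by case: c => /=; ring. Qed.

Lemma apiE (F : numFieldType) (c : foliation) (z : 'rV[F]_5) v :
  api c z v = rsubmx v 0 4 - vb z * theta v - api_shift c z * w1 v.
Proof. by case: c; rewrite /api /api_shift ?mul0r. Qed.

Lemma graph_plane_coord (F : numFieldType) (p : 'M[F]_(3, 5)) v j :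
  v \in graph_plane p ->
  rsubmx v 0 j = w1 v * p 0 j + w2 v * p 1 j + theta v * p 2 j.
Proof.
move=> /mem_graph_plane ->; rewrite mxE !big_ord_recl big_ord0 /w1 /w2 /theta.
rewrite (_ : lift 0 0 = 1); last exact/val_inj.
by rewrite (_ : lift 0 (lift 0 0) = 2) ?addr0 ?addrA //; exact/val_inj.
Qed.

Lemma graph_plane_frame (F : numFieldType) (p : 'M[F]_(3, 5)) (a b t : F) :
  exists v, [/\ v \in graph_plane p, w1 v = a, w2 v = b & theta v = t].
Proof.
pose x : 'rV[F]_3 := \row_i nth 0 [:: a; b; t] i.
exists (row_mx x (x *m p)); split.
- by apply/mem_graph_plane; rewrite row_mxKl row_mxKr.
- by rewrite /w1 row_mxKl mxE.
- by rewrite /w2 row_mxKl mxE.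
- by rewrite /theta row_mxKl mxE.
Qed.

(** Rows of [p] belong to w1, w2, theta and columns to K, a, K1, K2, b. The first two groups are the
    Pfaffian equations, the third says that pi1, pi2, pi3 have no theta component, and the last two
    are the relations of Cartan's lemma. *)
Definition integral_conditions (F : numFieldType) (c : foliation) (z : 'rV[F]_5)
    (p : 'M[F]_(3, 5)) : Prop :=
  [/\ [/\ p 0 0 = vK1 z, p 1 0 = vK2 z & p 2 0 = 2 * vK z],
      [/\ p 0 1 = vb z * leaf1 c z, p 1 1 = vb z * leaf2 F c & p 2 1 = 0],
      [/\ p 2 2 = 3 * vK1 z, p 2 3 = 3 * vK2 z & p 2 4 = vb z],
      p 1 2 - p 0 3 = 2 * vK z ^+ 2
    & leaf2 F c * p 0 4 - leaf1 c z * p 1 4 = leaf2 F c * api_shift c z].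

(** The forms are evaluated on the basis of the plane dual to w1, w2, theta; conversely the
    conditions cancel all terms of the wedge products. *)
Lemma integral_elementP (F : numFieldType) (c : foliation) (z : 'rV[F]_5) p :
  integral_element (web_system F c) z (graph_plane p) <-> integral_conditions c z p.
Proof.
have pK : pfaff1 (web_system F c) (@kphi F) by apply/pfaff1_web; left.
have pA : pfaff1 (web_system F c) (@aphi F c) by apply/pfaff1_web; right.
split.
- case=> phi0 dphi0 _.
  have [e1 [E1 e11 e12 e13]] := graph_plane_frame p 1 0 0.
  have [e2 [E2 e21 e22 e23]] := graph_plane_frame p 0 1 0.
  have [e3 [E3 e31 e32 e33]] := graph_plane_frame p 0 0 1.
  have eE := (e11, e12, e13, e21, e22, e23, e31, e32, e33).
  have C1 j : rsubmx e1 0 j = p 0 j by rewrite (graph_plane_coord _ E1) !eE; ring.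
  have C2 j : rsubmx e2 0 j = p 1 j by rewrite (graph_plane_coord _ E2) !eE; ring.
  have C3 j : rsubmx e3 0 j = p 2 j by rewrite (graph_plane_coord _ E3) !eE; ring.
  have K1 := phi0 _ pK _ E1; have K2 := phi0 _ pK _ E2; have K3 := phi0 _ pK _ E3.
  have A1 := phi0 _ pA _ E1; have A2 := phi0 _ pA _ E2; have A3 := phi0 _ pA _ E3.
  have := dphi0 _ pK _ _ E1 E2; rewrite ext_d1_kphi // => K12.
  have := dphi0 _ pK _ _ E1 E3; rewrite ext_d1_kphi // => K13.
  have := dphi0 _ pK _ _ E2 E3; rewrite ext_d1_kphi // => K23.
  have := dphi0 _ pA _ _ E1 E2; rewrite ext_d1_aphi // => A12.
  have := dphi0 _ pA _ _ E1 E3; rewrite ext_d1_aphi // => A13.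
  have := dphi0 _ pA _ _ E2 E3; rewrite ext_d1_aphi // => A23.
  rewrite /wedge /kpi1 /kpi2 !C1 !C2 !C3 !eE in K12 K13 K23.
  rewrite /wedge !apiE !leaf_formE !C1 !C2 !C3 !eE in A12 A13 A23.
  rewrite /kphi /dK ?C1 ?C2 ?C3 !eE in K1 K2 K3.
  rewrite /aphi /da !leaf_formE ?C1 ?C2 ?C3 !eE in A1 A2 A3.
  split; first split.
  + by apply/eqP; rewrite -subr_eq0 -[X in _ == X]K1; apply/eqP; ring.
  + by apply/eqP; rewrite -subr_eq0 -[X in _ == X]K2; apply/eqP; ring.
  + by apply/eqP; rewrite -subr_eq0 -[X in _ == X]K3; apply/eqP; ring.
  + split.
    * by apply/eqP; rewrite -subr_eq0 -[X in _ == X]A1; apply/eqP; ring.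
    * by apply/eqP; rewrite -subr_eq0 -[X in _ == X]A2; apply/eqP; ring.
    * by rewrite -[RHS]A3; ring.
  + split.
    * by apply/eqP; rewrite -subr_eq0 -[X in _ == X]K13; apply/eqP; ring.
    * by apply/eqP; rewrite -subr_eq0 -[X in _ == X]K23; apply/eqP; ring.
    (* One of [leaf1], [leaf2] equals 1: the first for [X1], the second otherwise. *)
    * have : leaf1 c z * (p 2 4 - vb z) = 0 by rewrite -[RHS]A13; ring.
      have : leaf2 F c * (p 2 4 - vb z) = 0 by rewrite -[RHS]A23; ring.
      by case: (c) => /=; rewrite !mul1r => /eqP + /eqP; rewrite !subr_eq0 => /eqP // _ /eqP.
  + by apply/eqP; rewrite -subr_eq0 -[X in _ == X]K12; apply/eqP; ring.
  + by apply/eqP; rewrite -subr_eq0 -oppr_eq0 -[X in _ == X]A12; apply/eqP; ring.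
case=> [[K1 K2 K3] [A1 A2 A3] [K13 K23 A4]] K12 A12.
have p12 : p 1 2 = p 0 3 + 2 * vK z ^+ 2 by rewrite -K12; ring.
have phiK v : v \in graph_plane p -> kphi z v = 0.
  by move=> E; rewrite /kphi /dK (graph_plane_coord _ E) K1 K2 K3; ring.
have phiA v : v \in graph_plane p -> aphi c z v = 0.
  by move=> E; rewrite /aphi /da (graph_plane_coord _ E) leaf_formE A1 A2 A3; ring.
split.
- by move=> phi /pfaff1_web[] -> v; [exact: phiK | exact: phiA].
- move=> phi /pfaff1_web[] -> u v Eu Ev.
  + rewrite ext_d1_kphi ?phiK // /wedge /kpi1 /kpi2.
    by rewrite !(graph_plane_coord _ Eu) !(graph_plane_coord _ Ev) K13 K23 p12; ring.
  + rewrite ext_d1_aphi ?phiA // /wedge !apiE !leaf_formE.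
    rewrite !(graph_plane_coord _ Eu) !(graph_plane_coord _ Ev) A4.
    transitivity ((w1 v * w2 u - w1 u * w2 v) *
      (leaf2 F c * p 0 4 - leaf1 c z * p 1 4 - leaf2 F c * api_shift c z)).
      by ring.
    by rewrite A12 subrr mulr0.
- by move=> i u v w Eu Ev Ew; rewrite ddcoframe_eq0 ?phiK.
Qed.

(** The eleven conditions are independent affine equations on the fifteen entries of [p]. *)
Lemma integral_elements_affine (F : numFieldType) (c : foliation) (z : 'rV[F]_5) :
  exists (p0 : 'M[F]_(3, 5)) (U : {vspace 'M[F]_(3, 5)}),
    (forall p, integral_element (web_system F c) z (graph_plane p) <-> p - p0 \in U) /\
    \dim U = 4%N.
Proof.
pose e i j (m : 'M[F]_(3, 5)) := m i j.
pose ls := [:: e 0 0; e 1 0; e 2 0; e 0 1; e 1 1; e 2 1; e 2 2; e 2 3; e 2 4;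
  fun m => e 1 2 m - e 0 3 m; fun m => leaf2 F c * e 0 4 m - leaf1 c z * e 1 4 m].
have lin i : scalar (nth (fun=> 0) ls i).
  do 11! [case: i => [|i]; first by move=> a u v; rewrite /= /e !mxE /=; ring].
  by move=> a u v /=; rewrite nth_nil mulr0 addr0.
have [U [UE _ Udim]] := kernel_codim lin.
(* A particular solution, with the entries (0,2), (0,3), (1,3) and (1,4) set to 0. *)
pose p0 : 'M[F]_(3, 5) := \matrix_(i, j) nth 0 (nth [::]
  [:: [:: vK1 z; vb z * leaf1 c z; 0; 0; api_shift c z];
      [:: vK2 z; vb z * leaf2 F c; 2 * vK z ^+ 2; 0; 0];
      [:: 2 * vK z; 0; 3 * vK1 z; 3 * vK2 z; vb z]] i) j.
exists p0, U; split.
- move=> p; split.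
  + move=> /integral_elementP[[K1 K2 K3] [A1 A2 A3] [K13 K23 A4] K12 A12].
    apply/UE => i i_lt.
    do 9! [case: i i_lt => [|i] i_lt; first by
      rewrite /= /e !mxE /= ?K1 ?K2 ?K3 ?A1 ?A2 ?A3 ?K13 ?K23 ?A4 ?subrr].
    case: i i_lt => [|[|//]] _; rewrite /= /e !mxE /=.
    * by rewrite subr0 addrAC K12 subrr.
    * by rewrite subr0 mulrBr addrAC A12 subrr.
  + move=> /UE pU.
    have P0 := pU 0%N isT; have P1 := pU 1%N isT; have P2 := pU 2%N isT.
    have P3 := pU 3%N isT; have P4 := pU 4%N isT; have P5 := pU 5%N isT.
    have P6 := pU 6%N isT; have P7 := pU 7%N isT; have P8 := pU 8%N isT.
    have P9 := pU 9%N isT; have P10 := pU 10%N isT.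
    rewrite /= /e !mxE /= in P0 P1 P2 P3 P4 P5 P6 P7 P8 P9 P10.
    apply/integral_elementP; split; first split.
    * exact: subr0_eq P0.
    * exact: subr0_eq P1.
    * exact: subr0_eq P2.
    * by split; [exact: subr0_eq P3 | exact: subr0_eq P4 | rewrite -P5 subr0].
    * by split; [exact: subr0_eq P6 | exact: subr0_eq P7 | exact: subr0_eq P8].
    * by apply: subr0_eq; rewrite -[RHS]P9; ring.
    * by apply: subr0_eq; rewrite -[RHS]P10; ring.
- apply/eqP; rewrite -(eqn_add2r 11); apply/eqP.
  rewrite -[X in (_ + X)%N = _]/(size ls) Udim ?dimvf // => y.
  (* The last equation is solved through entry (0,4) when [leaf2] is 1, and through entry (1,4) for
     [X1], where it reads - p 1 4 = y 10. *)
  exists (\matrix_(i, j) nth 0 (nth [::]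
    [:: [:: y 0%N; y 3%N; 0; 0; if c is X1 then 0 else y 10%N];
        [:: y 1%N; y 4%N; y 9%N; 0; if c is X1 then - y 10%N else 0];
        [:: y 2%N; y 5%N; y 6%N; y 7%N; y 8%N]] i) j) => i i_lt.
  do 11! [case: i i_lt => [|i] i_lt; first by
    rewrite /= /e !mxE /= ?subr0 //; case: (c) => /=; ring].
  by [].
Qed.

(* The forms pi_i minus their expressions on the integral element dz = w p;
   they vanish on that element and have the same polar equations as pi_i. *)
Definition kres1 (F : numFieldType) (z : 'rV[F]_5) (p : 'M[F]_(3, 5)) v : F :=
  kpi1 z v - (p 0 2 * w1 v + p 1 2 * w2 v).

Definition kres2 (F : numFieldType) (z : 'rV[F]_5) (p : 'M[F]_(3, 5)) v : F :=
  kpi2 z v - (p 1 2 * w1 v + p 1 3 * w2 v).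

Definition ares (F : numFieldType) (c : foliation) (z : 'rV[F]_5)
    (p : 'M[F]_(3, 5)) v : F :=
  api c z v - ((p 0 4 - api_shift c z) * w1 v + p 1 4 * w2 v).

(** * Polar spaces and their generic codimension *)

(** Replacing each pi_i by its residual form leaves the 2-forms unchanged, by the symmetry of the
    coefficients. The residual forms vanish on [E'], so only one term of each wedge product
    survives. *)
Lemma polar_vectorP (F : numFieldType) (c : foliation) (z : 'rV[F]_5) p
    (E' : {vspace 'rV[F]_(3 + 5)}) v :
  integral_element (web_system F c) z (graph_plane p) ->
  (E' <= graph_plane p)%VS ->
  polar_vector (web_system F c) z E' v <->
  [/\ kphi z v = 0, aphi c z v = 0
    & forall u, u \in E' ->
        kres1 z p v * w1 u + kres2 z p v * w2 u = 0 /\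
        ares c z p v * leaf_form c z u = 0].
Proof.
move=> intE /subvP subE.
have [[K1 K2 K3] [A1 A2 A3] [K13 K23 A4] K12 A12] := (integral_elementP c z p).1 intE.
have p12 : p 1 2 = p 0 3 + 2 * vK z ^+ 2 by rewrite -K12; ring.
have [phi0 _ _] := intE.
have pK : pfaff1 (web_system F c) (@kphi F) by apply/pfaff1_web; left.
have pA : pfaff1 (web_system F c) (@aphi F c) by apply/pfaff1_web; right.
have dK u : kphi z v = 0 -> u \in E' -> ext_d1 (web_system F c) (@kphi F) z v u =
    - (kres1 z p v * w1 u + kres2 z p v * w2 u).
  move=> v0 /subE Eu; rewrite ext_d1_kphi ?(phi0 _ pK _ Eu) //.
  by rewrite /wedge /kres1 /kres2 /kpi1 /kpi2 !(graph_plane_coord _ Eu) K13 K23 p12; ring.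
have dA u : aphi c z v = 0 -> u \in E' -> ext_d1 (web_system F c) (@aphi F c) z v u =
    - (ares c z p v * leaf_form c z u).
  move=> v0 /subE Eu; rewrite ext_d1_aphi ?(phi0 _ pA _ Eu) //.
  rewrite /wedge /ares !apiE !leaf_formE !(graph_plane_coord _ Eu) A4.
  apply/eqP; rewrite -subr_eq0; apply/eqP.
  transitivity ((w1 v * w2 u - w1 u * w2 v) *
    (leaf1 c z * p 1 4 + leaf2 F c * api_shift c z - leaf2 F c * p 0 4)); first by ring.
  by rewrite -A12; ring.
split=> [[v0 dv _]|[vK vA vE]].
  split; [exact: v0 | exact: v0 | move=> u Eu].
  split; apply: oppr_inj; rewrite oppr0.
    by rewrite -dK ?dv //; exact: v0.
  by rewrite -dA ?dv //; exact: v0.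
split.
- by move=> phi /pfaff1_web[] ->.
- by move=> phi /pfaff1_web[] -> u Eu; have [e1 e2] := vE u Eu;
  rewrite ?dK ?dA // ?e1 ?e2 oppr0.
- move=> i u w /subE Eu /subE Ew.
  by rewrite ddcoframe_eq0 ?vK ?(phi0 _ pK _ Eu) ?(phi0 _ pK _ Ew).
Qed.

(** An upper bound needs only one inclusion: the common kernel of the forms, independent or not,
    lies in the polar space. *)
Lemma polar_codim_le (F : numFieldType) (n N : nat) (S : cartan_system F n N)
    (z : 'rV[F]_N) (E : {vspace 'rV[F]_(n + N)}) (ls : seq ('rV[F]_(n + N) -> F)) (k : nat) :
  (forall i, scalar (nth (fun=> 0) ls i)) ->
  (forall v, (forall i, (i < size ls)%N -> nth (fun=> 0) ls i v = 0) ->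
     polar_vector S z E v) ->
  polar_codim S z E k -> (k <= size ls)%N.
Proof.
move=> lin lsE [H dimH HE]; have [H0 [H0E H0dim _]] := kernel_codim lin.
have H0H : (H0 <= H)%VS by apply/subvP => v /H0E/lsE/HE.
rewrite dimvf /dim /= mul1n in H0dim.
by rewrite -(leq_add2l (\dim H)) dimH (leq_trans H0dim) // leq_add2r dimvS.
Qed.

Lemma polar_codim_eq (F : numFieldType) (n N : nat) (S : cartan_system F n N)
    (z : 'rV[F]_N) (E : {vspace 'rV[F]_(n + N)}) (ls : seq ('rV[F]_(n + N) -> F)) :
  (forall i, scalar (nth (fun=> 0) ls i)) ->
  (forall v, polar_vector S z E v <->
     forall i, (i < size ls)%N -> nth (fun=> 0) ls i v = 0) ->
  (forall y : nat -> F, exists v,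
     forall i, (i < size ls)%N -> nth (fun=> 0) ls i v = y i) ->
  polar_codim S z E (size ls).
Proof.
move=> lin lsE surj; have [H [HE _ /(_ surj) dimH]] := kernel_codim lin.
exists H; first by rewrite dimH dimvf /dim /= mul1n.
by move=> v; split=> [/lsE/HE | /HE/lsE].
Qed.

(** The five forms have leading terms dK, da, dK1, dK2, db, so a vector with zero coframe part
    attains any prescribed values. *)
Lemma polar_form_values (F : numFieldType) (c : foliation) (z : 'rV[F]_5) p (y : nat -> F) :
  exists v, [/\ kphi z v = y 0%N, aphi c z v = y 1%N &
    [/\ kres1 z p v = y 2%N, kres2 z p v = y 3%N & ares c z p v = y 4%N]].
Proof.
pose v : 'rV[F]_(3 + 5) :=
  row_mx 0 (\row_j nth 0 [:: y 0%N; y 1%N; y 2%N; y 3%N; y 4%N] j).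
have [v1 v2 v3] : [/\ w1 v = 0, w2 v = 0 & theta v = 0].
  by rewrite /w1 /w2 /theta row_mxKl !mxE.
exists v; rewrite /kphi /aphi /kres1 /kres2 /ares /kpi1 /kpi2 apiE leaf_formE.
by rewrite /dK /da v1 v2 v3 row_mxKr !mxE /= !(mulr0, addr0, subr0).
Qed.

Lemma scalar_kphi (F : numFieldType) (z : 'rV[F]_5) : scalar (kphi z).
Proof. by move=> a u v; rewrite /kphi /dK /theta /w1 /w2 !mxE; ring. Qed.

Lemma scalar_aphi (F : numFieldType) (c : foliation) (z : 'rV[F]_5) : scalar (aphi c z).
Proof. by move=> a u v; rewrite /aphi !leaf_formE /da /theta /w1 /w2 !mxE; ring. Qed.

Lemma scalar_kres1 (F : numFieldType) (z : 'rV[F]_5) p : scalar (kres1 z p).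
Proof. by move=> a u v; rewrite /kres1 /kpi1 /theta /w1 /w2 !mxE; ring. Qed.

Lemma scalar_kres2 (F : numFieldType) (z : 'rV[F]_5) p : scalar (kres2 z p).
Proof. by move=> a u v; rewrite /kres2 /kpi2 /theta /w1 /w2 !mxE; ring. Qed.

Lemma scalar_ares (F : numFieldType) (c : foliation) (z : 'rV[F]_5) p : scalar (ares c z p).
Proof. by move=> a u v; rewrite /ares !apiE /theta /w1 /w2 !mxE; ring. Qed.

Lemma notin_span (K : fieldType) (V : vectType K) (l : V -> K) (X : seq V) v :
  scalar l -> {in X, forall x, l x = 0} -> l v != 0 -> v \notin <<X>>%VS.
Proof.
move=> lin lX lv; have lin1 i : scalar (nth (fun=> 0) [:: l] i).
  by case: i => [|i] // a x y; rewrite nth_default //= mulr0 addr0.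
have [H [HE _ _]] := kernel_codim lin1.
apply: contra lv => /(subvP _); have /span_subvP XH : {subset X <= H}.
  by move=> x /lX lx; apply/HE => -[].
by move=> /(_ _ XH)/HE/(_ 0%N isT) /= ->.
Qed.

(** In each dimension an upper bound valid for all subspaces is matched by one subspace: two forms
    cut out the polar space of 0, each 2-form adds one equation on a line, and five forms suffice on
    any subspace. *)
Lemma web_generic_polar_codim (F : numFieldType) (c : foliation) (z : 'rV[F]_5) p :
  integral_element (web_system F c) z (graph_plane p) ->
  forall k, (k <= 3)%N ->
    generic_polar_codim (web_system F c) z (graph_plane p) k
      (nth 0%N [:: 2; 4; 5; 5] k).
Proof.
move=> intE.
pose all5 := [:: kphi z; aphi c z; kres1 z p; kres2 z p; ares c z p].
have lin5 i : scalar (nth (fun=> 0) all5 i).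
  case: i => [|[|[|[|[|i]]]]]; [exact: scalar_kphi | exact: scalar_aphi |
    exact: scalar_kres1 | exact: scalar_kres2 | exact: scalar_ares |].
  by move=> a u v; rewrite nth_default //= mulr0 addr0.
pose two := [:: kphi z; aphi c z].
have lin2 i : scalar (nth (fun=> 0) two i).
  case: i => [|[|i]]; [exact: scalar_kphi | exact: scalar_aphi |].
  by move=> a u v; rewrite nth_default //= mulr0 addr0.
pose four u := [:: kphi z; aphi c z;
  (fun v => kres1 z p v * w1 u + kres2 z p v * w2 u);
  (fun v => ares c z p v * leaf_form c z u)].
have lin4 u i : scalar (nth (fun=> 0) (four u) i).
  case: i => [|[|[|[|i]]]]; [exact: scalar_kphi | exact: scalar_aphi | | |].
  - by move=> a x y /=; rewrite scalar_kres1 scalar_kres2; ring.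
  - by move=> a x y /=; rewrite scalar_ares; ring.
  - by move=> a x y; rewrite nth_default //= mulr0 addr0.
have polar5 (E' : {vspace 'rV[F]_(3 + 5)}) v : (E' <= graph_plane p)%VS ->
    (forall i, (i < 5)%N -> nth (fun=> 0) all5 i v = 0) ->
    polar_vector (web_system F c) z E' v.
  move=> sE v0; apply/(polar_vectorP v intE sE); split.
  - exact: v0 0%N isT.
  - exact: v0 1%N isT.
  - have := (v0 2%N isT, v0 3%N isT, v0 4%N isT) => -[[/= -> ->] ->] u _.
    by rewrite !mul0r addr0.
have polar4 u v : u \in graph_plane p ->
    polar_vector (web_system F c) z <[u]>%VS v <->
    (forall i, (i < 4)%N -> nth (fun=> 0) (four u) i v = 0).
  move=> Eu; have sE : (<[u]> <= graph_plane p)%VS by rewrite -memvE.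
  split=> [/(polar_vectorP v intE sE)[v0 v1 /(_ u (memv_line u))[v2 v3]]|v0].
    by case=> [|[|[|[|]]]].
  apply/(polar_vectorP v intE sE); split; [exact: v0 0%N isT | exact: v0 1%N isT |].
  move=> _ /vlineP[k ->].
  have wZ : w1 (k *: u) = k * w1 u /\ w2 (k *: u) = k * w2 u.
    by rewrite /w1 /w2 !mxE.
  rewrite leaf_formE !wZ.1 !wZ.2.
  have := v0 2%N isT; have := v0 3%N isT; rewrite /= leaf_formE => v3 v2; split.
    by transitivity (k * (kres1 z p v * w1 u + kres2 z p v * w2 u)); [ring | rewrite v2 mulr0].
  transitivity (k * (ares c z p v * (leaf1 c z * w1 u + leaf2 F c * w2 u))); first by ring.
  by rewrite v3 mulr0.
have polar2 v : polar_vector (web_system F c) z 0%VS v <->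
    (forall i, (i < 2)%N -> nth (fun=> 0) two i v = 0).
  have sE : (0 <= graph_plane p)%VS by exact: sub0v.
  split=> [/(polar_vectorP v intE sE)[v0 v1 _]|v0]; first by case=> [|[|]].
  apply/(polar_vectorP v intE sE); split; [exact: v0 0%N isT | exact: v0 1%N isT |].
  move=> u; rewrite memv0 => /eqP ->; rewrite leaf_formE /w1 /w2 !mxE.
  by rewrite !mulr0 !addr0 mulr0.
(* The second coordinate is chosen so that both w1 and lambda take the value 1 on [e1], which makes
   its line generic. *)
have [e1 [E1 e11 e12 e13]] : exists e, [/\ e \in graph_plane p, w1 e = 1,
    w2 e = (if c is X4 then 1 - va z else if c is X2 then 1 else 0) & theta e = 0].
  exact: graph_plane_frame.
have e1_leaf : leaf_form c z e1 = 1.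
  by rewrite leaf_formE e11 e12; case: (c) => /=; ring.
have [e2 [E2 e21 e22 e23]] := graph_plane_frame p 0 1 0.
have [e3 [E3 e31 e32 e33]] := graph_plane_frame p 0 0 1.
have w1_scalar : scalar (@w1 F) by move=> a x y; rewrite /w1 !mxE.
have w2_scalar : scalar (@w2 F) by move=> a x y; rewrite /w2 !mxE.
have th_scalar : scalar (@theta F) by move=> a x y; rewrite /theta !mxE.
have free3 : free [:: e1; e2; e3].
  (* The values of w1, w2, theta on the three vectors form a triangular array with unit diagonal. *)
  rewrite !free_cons nil_free andbT.
  rewrite (notin_span w1_scalar) ?e11 ?oner_eq0 //; last first.
    by move=> x; rewrite !inE => /orP[]/eqP ->.
  rewrite (notin_span w2_scalar) ?e22 ?oner_eq0 //; last first.
    by move=> x; rewrite !inE => /eqP ->.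
  by rewrite (notin_span th_scalar) ?e33 ?oner_eq0.
have polar_eq5 (E' : {vspace 'rV[F]_(3 + 5)}) : (E' <= graph_plane p)%VS ->
    e1 \in E' -> e2 \in E' -> polar_codim (web_system F c) z E' 5.
  move=> sE e1E e2E; apply: (polar_codim_eq (ls := all5)) => // [v|y].
    split; last exact: polar5.
    case/(polar_vectorP v intE sE) => v0 v1 v2.
    have [a1 a2] := v2 _ e1E; have [b1 _] := v2 _ e2E.
    (* Since w1 vanishes on [e2], that vector isolates [kres2]; [e1] then gives [kres1]. *)
    have r2 : kres2 z p v = 0 by rewrite -[RHS]b1 e21 e22; ring.
    have r1 : kres1 z p v = 0 by rewrite -[RHS]a1 e11 r2; ring.
    have r3 : ares c z p v = 0 by rewrite -[RHS]a2 e1_leaf mulr1.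
    by case=> [|[|[|[|[|]]]]].
  have [v [v0 v1 [v2 v3 v4]]] := polar_form_values c z p y.
  by exists v; case=> [|[|[|[|[|]]]]].
have polar_le5 (E' : {vspace 'rV[F]_(3 + 5)}) k : (E' <= graph_plane p)%VS ->
    polar_codim (web_system F c) z E' k -> (k <= 5)%N.
  by move=> sE; apply: (polar_codim_le (ls := all5)) => // v; exact: polar5.
case=> [|[|[|[|//]]]] _ /=; split.
- exists 0%VS; rewrite sub0v dimv0; split=> //.
  apply: (polar_codim_eq (ls := two)) => // y.
  have [v [v0 v1 _]] := polar_form_values c z p y.
  by exists v; case=> [|[|]].
- move=> E' k sE /eqP; rewrite dimv_eq0 => /eqP E'0; rewrite E'0.
  by apply: (polar_codim_le (ls := two)) => // v; apply: (polar2 v).2.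
- exists <[e1]>%VS; rewrite -memvE dim_vline; split=> //.
    by rewrite (_ : e1 != 0) //; apply: contraTneq (oner_neq0 F) => e0;
      rewrite -e11 e0 /w1 !mxE eqxx.
  apply: (polar_codim_eq (ls := four e1)) => // [v|y]; first exact: polar4.
  (* With [kres2] set to 0, the third form is [kres1], as w1 is 1 on [e1]. *)
  have [v [v0 v1 [v2 v3 v4]]] := polar_form_values c z p
    (nth 0 [:: y 0%N; y 1%N; y 2%N; 0; y 3%N]).
  exists v; case=> [|[|[|[|//]]]] _ //=; rewrite ?v2 ?v3 ?v4 ?e11 ?e1_leaf /=; ring.
- move=> E' k sE dimE.
  have E'E : E' = <[vpick E']>%VS.
    apply/esym/eqP; rewrite eqEdim -memvE memv_pick dimE dim_vline vpick0.
    by rewrite -dimv_eq0 dimE.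
  have Eu : vpick E' \in graph_plane p by apply: (subvP sE); exact: memv_pick.
  rewrite E'E; apply: (polar_codim_le (ls := four (vpick E'))) => // v.
  by apply: (polar4 _ _ _).2.
- exists <<[:: e1; e2]>>%VS; split.
  + by apply/span_subvP => x; rewrite !inE => /orP[]/eqP ->.
  + have /eqP -> // : free [:: e1; e2].
    exact: catl_free (free3 : free ([:: e1; e2] ++ [:: e3])).
  + apply: polar_eq5; [|apply: memv_span..]; rewrite ?inE ?eqxx ?orbT //.
    by apply/span_subvP => x; rewrite !inE => /orP[]/eqP ->.
- by move=> E' k sE _; exact: polar_le5.
- exists <<[:: e1; e2; e3]>>%VS; split.
  + by apply/span_subvP => x; rewrite !inE => /or3P[]/eqP ->.
  + exact: (eqP free3).
  + apply: polar_eq5; [|apply: memv_span..]; rewrite ?inE ?eqxx ?orbT //.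
    by apply/span_subvP => x; rewrite !inE => /or3P[]/eqP ->.
- by move=> E' k sE _; exact: polar_le5.
Qed.

Lemma web_system_general_solution (F : numFieldType) (c : foliation) :
  general_solution_depends_on (web_system F c) 1 2.
Proof.
(* The characters are the successive increments of the codimensions 2, 4, 5, 5; the default value 0
   supplies s3. *)
exists (nth 0%N [:: 2; 2; 1]%N); split=> //; last by case=> [|[|[|[|]]]].
move=> z _; split.
  have [p0 [U [UE dimU]]] := integral_elements_affine c z.
  by exists p0, U; split=> //; rewrite dimU unlock.
move=> p intE k k3; have := web_generic_polar_codim intE k3.
by case: k k3 => [|[|[|[|//]]]] _; rewrite unlock.
Qed.

Theorem proposition5 (R : realType) (F : numFieldType)
    (hF : F = R :> numFieldType \/ F = R[i] :> numFieldType)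
    (c : foliation) :
  (exists (D : set 'rV[F]_2) (w : foliation -> 'rV[F]_2 -> 'cV[F]_2)
      (a : 'rV[F]_2 -> F^o),
      [/\ is_4web D w a,
          constant_on_leaves D (w c) a
        & exists x y, [/\ D x, D y & a x != a y]]) /\
  general_solution_depends_on (web_system F c) 1 2.
Proof.
split; last exact: web_system_general_solution.
by have [rs] := real_scalars_exist hF; exact: (exists_web_constant_on_leaves rs).
Qed.
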